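(* There exists an absolute constant $c>0$ such that the following holds. Let $N\ge 2$ be an integer and let $A\in\mathbb{R}^{N\times N}$ be a real matrix of rank $n$ such that $$\max_{1\le i,j\le N}|A_{i,j}-\delta_{i,j}|\le \frac13 .$$ Put $\gamma := c\,\max\{n^{-3/2}\log N,\; n^{-1}\}$. Then $$F_A^*(\gamma)\;\ge\; c\,\frac{\log N}{n\,\log\!\left(2+\frac{n}{\log N}\right)} .$$
   Context: $\delta_{i,j}$ is the Kronecker delta (the entries of the identity matrix). For a matrix $A\in\mathbb{R}^{N\times N}$ and a real number $\gamma$, the distribution function is $F^*_A(\gamma) := N^{-2}\,|\{(i,j)\in\{1,\dots,N\}^2\colon |A_{i,j}|>\gamma\}|$, i.e. the proportion of entries of $A$ whose absolute value is strictly greater than $\gamma$. ''Absolute constant'' means that $c$ does not depend on $N$, $n$ or $A$; the same constant $c$ appears in the definition of $\gamma$ and in the bound. $\log$ is the natural logarithm (the choice of base affects only the constant $c$). *)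

(* Defs.v *)
From mathcomp Require Import all_boot all_order all_algebra.
From mathcomp Require Import all_classical all_reals all_analysis.

Set Implicit Arguments.
Unset Strict Implicit.
Unset Printing Implicit Defensive.

Import Order.TTheory GRing.Theory Num.Theory.
Local Open Scope ring_scope.

Definition entry_distribution (R : realType) (N : nat) (A : 'M[R]_N)
    (gamma : R) : R :=
  #|[set ij : 'I_N * 'I_N | gamma < `|A ij.1 ij.2| ]%SET|%:R / N%:R ^+ 2.

(* The base 0 of the iterated maximum is harmless: the terms are nonnegative. *)
Definition max_entry_dist_id (R : realType) (N : nat) (A : 'M[R]_N) : R :=
  \big[Num.max/0]_(i < N) \big[Num.max/0]_(j < N) `|A i j - (i == j)%:R|.

Definition threshold (R : realType) (c : R) (N n : nat) : R :=
  c * Num.max (n%:R `^ (- (3 / 2)) * ln N%:R) n%:R^-1.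

(* Main.v *)
Require Import Defs.
From mathcomp Require Import all_boot all_order all_algebra.
From mathcomp Require Import all_classical all_reals all_analysis.
From mathcomp Require Import ring lra zify.

Set Implicit Arguments.
Unset Strict Implicit.
Unset Printing Implicit Defensive.

Import Order.TTheory GRing.Theory Num.Theory.
Local Open Scope ring_scope.

(* Choose 2n rows of A, n = rank A, spanning all the others with coefficient
   vectors of Euclidean norm at most 1 (a maximal-volume choice). Entries of size
   at most c n^(-1/2) in these rows then contribute at most 1/24 to any entry of
   A, so they may be erased; as log N = O(n), the threshold of the theorem is
   O(c n^(-1/2)). If the chosen rows contained few large entries, most columns of
   A would become t-sparse in the new coordinates, with A still close to the
   identity. The entrywise k-th power of such a matrix is column-dominant for
   k ~ log N, hence nonsingular, while its rank is at most the number of monomials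
   of degree k in 2n variables with support of size at most t. This forces
   t >~ log N / log(2 + n / log N). Applied to the submatrix on the rows and
   columns of A with few large entries, it shows that at least half of the rows
   have about N t / n large entries. *)

(** * Determinants of rank-two updates and row frames *)

(** Sylvester's identity: the block matrix with identity diagonal and off-diagonal blocks [B], [C]
    factors in two ways into block triangular matrices. *)
Lemma det_1subMC (R : comNzRingType) (m n : nat) (B : 'M[R]_(m, n)) (C : 'M[R]_(n, m)) :
  \det (1%:M - B *m C) = \det (1%:M - C *m B).
Proof.
have eL : block_mx (1%:M - B *m C) B 0 1%:M *m block_mx 1%:M 0 C 1%:M
    = block_mx 1%:M B C 1%:M :> 'M[R]_(m + n).
  by rewrite mulmx_block !(mulmx0, mul0mx, mulmx1, mul1mx, add0r, addr0) subrK.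
have eR : block_mx 1%:M 0 C 1%:M *m block_mx 1%:M B 0 (1%:M - C *m B)
    = block_mx 1%:M B C 1%:M :> 'M[R]_(m + n).
  by rewrite mulmx_block !(mulmx0, mul0mx, mulmx1, mul1mx, add0r, addr0) addrC subrK.
move: (congr1 determinant eL); rewrite -eR !det_mulmx !det_ublock !det_lblock.
by rewrite !det1 !mul1r !mulr1.
Qed.

Lemma det_mx2 (R : comNzRingType) (A : 'M[R]_(1 + 1)) :
  \det A = A 0 0 * A 1 1 - A 0 1 * A 1 0.
Proof.
rewrite (expand_det_row _ 0) !big_ord_recl big_ord0 addr0 /cofactor !det_mx11 !mxE /=.
rewrite /bump /= expr0 mul1r expr1 mulN1r mulrN; congr (_ * A _ _ - A _ _ * A _ _);
  exact/val_inj.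
Qed.

(** Writing the update as [G (1 - G^-1 X Y)] with [X = [u, -v]], [det_1subMC] reduces it to a 2 by 2
    determinant. *)
Lemma det_exchange (F : fieldType) (r : nat) (G : 'M[F]_r) (u v : 'cV[F]_r) :
  G \in unitmx -> G^T = G ->
  let K (x y : 'cV[F]_r) : F := (x^T *m invmx G *m y) 0 0 in
  \det (G - u *m u^T + v *m v^T)
    = \det G * ((1 - K u u) * (1 + K v v) + K v u ^+ 2).
Proof.
move=> Gu Gs K.
have Ksym : K u v = K v u.
  rewrite /K -[in RHS](trmxK (_ *m u)) [in RHS]mxE !trmx_mul trmxK trmx_inv Gs.
  by rewrite mulmxA.
pose X := row_mx u (- v); pose Y := col_mx u^T v^T.
have -> : G - u *m u^T + v *m v^T = G *m (1%:M - (invmx G *m X) *m Y).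
  rewrite mulmxBr mulmx1 !mulmxA mulmxV // mul1mx mul_row_col mulNmx.
  by rewrite opprD opprK addrA.
rewrite det_mulmx det_1subMC mulmxA mul_col_mx mul_col_row !mulmxN.
rewrite det_mx2; congr (_ * _).
have -> : (0 : 'I_(1 + 1)) = lshift 1 0 by exact/val_inj.
have -> : (1 : 'I_(1 + 1)) = rshift 1 0 by exact/val_inj.
have E M i j : (1%:M - M : 'M[F]_(1 + 1)) i j = (i == j)%:R - M i j by rewrite !mxE.
rewrite !E block_mxEul block_mxEur block_mxEdl block_mxEdr !eqxx.
rewrite eq_lrshift eq_rlshift.
have EN (M : 'M[F]_1) i j : (- M) i j = - M i j by rewrite mxE.
rewrite !EN -!/(K _ _) Ksym /=; ring.
Qed.

(** If [w V^T V = 0], the sum of the squares of the entries of [w V^T] vanishes, so [w V^T = 0]. *)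
Lemma gram_unitmx (F : realFieldType) (m r : nat) (V : 'M[F]_(m, r)) :
  row_full V -> V^T *m V \in unitmx.
Proof.
move=> Vfull; rewrite -row_free_unit; apply: inj_row_free => w wG0.
have Vfree : row_free V^T by rewrite /row_free mxrank_tr.
apply: (row_free_inj Vfree); rewrite mul0mx.
have : (w *m V^T) *m (w *m V^T)^T = 0.
  by rewrite trmx_mul trmxK !mulmxA -(mulmxA w) wG0 mul0mx.
move=> /matrixP /(_ 0 0); rewrite mxE [RHS]mxE => /eqP.
rewrite psumr_eq0 => [/allP w0|l _]; last by rewrite [X in _ * X]mxE -expr2 sqr_ge0.
apply/matrixP => i l; rewrite (ord1 i) [RHS]mxE.
have := w0 l (mem_index_enum l); rewrite [X in _ * X]mxE -expr2 sqrf_eq0.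
by move/eqP.
Qed.

(* Take the m rows of U (repetitions allowed) maximising |det| of their Gram
   matrix G. Replacing row f l by row i multiplies det G by
   (1 - K_ll) (1 + K_ii) + K_il^2 with K = U G^-1 U^T; this is at most 1, and
   summing over l, where the K_ll add up to r and the K_il^2 to K_ii, bounds
   K_ii, the squared norm of the i-th coefficient vector. *)
Lemma row_frame (F : realFieldType) (N m r : nat) (U : 'M[F]_(N, r)) (i0 : 'I_N) :
  row_full U -> (r <= m)%N ->
  exists (f : {ffun 'I_m -> 'I_N}) (C : 'M[F]_(N, m)),
    U = C *m rowsub f U
    /\ forall i, (\sum_l C i l ^+ 2) * (m.+1%:R - r%:R) <= r%:R.
Proof.
move=> Ufull rm.
pose G (f : {ffun 'I_m -> 'I_N}) := (rowsub f U)^T *m rowsub f U.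
have Gs f : (G f)^T = G f by rewrite /G trmx_mul trmxK.
have [f0 Gf0] : exists f0, \det (G f0) != 0.
  pose g : 'I_r -> 'I_N := fullrankfun Ufull.
  (* A start with nonzero Gram determinant: [r] independent rows, padded with copies of [i0]. *)
  pose f0 : {ffun 'I_m -> 'I_N} := [ffun l : 'I_m => oapp g i0 (insub (l : nat))].
  exists f0; rewrite -unitfE -unitmxE; apply: gram_unitmx.
  rewrite /row_full eqn_leq rank_leq_col /=.
  rewrite -{1}(mxrank_fullrowsub Ufull); apply/mxrankS.
  apply: (submx_rowsub (widen_ord rm)) => l /=.
  rewrite [RHS]ffunE; have -> : insub (widen_ord rm l : nat) = Some l by exact: valK.
  by [].
pose f := [arg max_(f > f0 | true) `|\det (G f)|]%O.
have fmax f' : `|\det (G f')| <= `|\det (G f)|.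
  by rewrite /f; case: arg_maxP => // g _ /(_ f' isT).
have Gf_neq0 : \det (G f) != 0.
  by rewrite -normr_gt0 (lt_le_trans _ (fmax f0)) // normr_gt0.
have Gfu : G f \in unitmx by rewrite unitmxE unitfE.
pose K i j : F := (row i U *m invmx (G f) *m (row j U)^T) 0 0.
pose C := U *m invmx (G f) *m (rowsub f U)^T.
have CE i l : C i l = K i (f l).
  by rewrite /K -row_mul /C !mxE; apply: eq_bigr => a _; rewrite !mxE.
have trK : \sum_l K (f l) (f l) = r%:R.
  transitivity (\tr (rowsub f C)); first by apply: eq_bigr => l _; rewrite mxE CE.
  rewrite /C -mul_rowsub_mx -mul_rowsub_mx mxtrace_mulC mulmxA mulmxV //.
  by rewrite mxtrace1.
have sumC i : \sum_l C i l ^+ 2 = K i i.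
  transitivity ((C *m C^T) i i).
    by rewrite [RHS]mxE; apply: eq_bigr => l _; rewrite expr2 [C^T l i]mxE.
  rewrite /C !trmx_mul trmxK trmx_inv Gs -!mulmxA (mulmxA _^T) -/(G f) mulKVmx //.
  by rewrite /K -row_mul mulmxA !mxE; apply: eq_bigr => a _; rewrite !mxE.
exists f, C; split.
  by rewrite /C -mulmxA -/(G f) mulmxKV.
move=> i; rewrite sumC.
have exch l : (1 - K (f l) (f l)) * (1 + K i i) + C i l ^+ 2 <= 1.
  pose f' : {ffun 'I_m -> 'I_N} := [ffun l' => if l' == l then i else f l'].
  have Gf' : G f' = G f - (row (f l) U)^T *m (row (f l) U)^T^T + (row i U)^T *m (row i U)^T^T.
    apply/matrixP => a b; rewrite !mxE !big_ord1 !mxE (bigD1 l) //= [in RHS](bigD1 l) //=.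
    rewrite !mxE !ffunE eqxx.
    under eq_bigr => l' l'l do rewrite !mxE ffunE (negPf l'l).
    under [in RHS]eq_bigr => l' _ do rewrite !mxE.
    ring.
  have := fmax f'; rewrite Gf' det_exchange // normrM ger_pMr ?normr_gt0 //.
  by rewrite !trmxK -!/(K _ _) CE; apply/le_trans/ler_norm.
have : \sum_(l < m) ((1 - K (f l) (f l)) * (1 + K i i) + C i l ^+ 2) <= \sum_(l < m) 1.
  by apply: ler_sum => l _; exact: exch.
rewrite big_split /= sumC -mulr_suml sumrB trK !sumr_const card_ord.
rewrite -[m.+1]addn1 natrD; lra.
Qed.

(** For [m = 2 * n] and [r <= n] the factor [m + 1 - r] in [row_frame] exceeds [r], whence the bound
    1. A relation between rows of the column base carries over to [A]. *)
Lemma rank_row_frame (F : realFieldType) (N q n : nat) (A : 'M[F]_(N, q)) :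
  (0 < N)%N -> (\rank A <= n)%N ->
  exists (f : 'I_(2 * n) -> 'I_N) (C : 'M[F]_(N, 2 * n)),
    A = C *m rowsub f A /\ forall i, \sum_l C i l ^+ 2 <= 1.
Proof.
move=> N0 rn.
have rm : (\rank A <= 2 * n)%N by rewrite mul2n -addnn (leq_trans rn) ?leq_addr.
have [f [C [UC Csq]]] := row_frame (Ordinal N0) (col_base_full A) rm.
exists f, C; split.
  by rewrite -[in RHS](mulmx_base A) -mul_rowsub_mx mulmxA -UC mulmx_base.
move=> i; have := Csq i; set s := \sum_l _.
have s0 : 0 <= s by apply: sumr_ge0 => l _; exact: sqr_ge0.
have : (\rank A)%:R <= n%:R :> F by rewrite ler_nat.
have -> : (2 * n).+1%:R = 2 * n%:R + 1 :> F by rewrite -addn1 natrD natrM.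
by have : 0 <= n%:R :> F by []; move: (n%:R) => x; nra.
Qed.

(** * Entrywise powers and monomials of small support *)

(** A nonzero left kernel vector would violate the equation of column [j], for [j] the index of its
    largest coordinate. *)
Lemma col_dominant_row_free (F : realFieldType) (p : nat) (H : 'M[F]_p) :
  (forall j, \sum_(i | i != j) `|H i j| < `|H j j|) -> row_free H.
Proof.
move=> dom; apply: inj_row_free => u uH; apply/eqP; apply/negPn/negP => /rV0Pn[i0 ui0].
pose j := [arg max_(i > i0 | true) `|u 0 i|]%O.
have jmax i : `|u 0 i| <= `|u 0 j|.
  by rewrite /j; case: arg_maxP => // a _ /(_ i isT).
have uj0 : 0 < `|u 0 j| by rewrite (lt_le_trans _ (jmax i0)) // normr_gt0.
have := congr1 (fun M : 'rV_p => M 0 j) uH; rewrite !mxE (bigD1 j) //=.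
move=> /eqP; rewrite addr_eq0 => /eqP e.
suff : `|u 0 j * H j j| < `|u 0 j| * `|H j j| by rewrite normrM ltxx.
rewrite e normrN (le_lt_trans (ler_norm_sum _ _ _)) //.
apply: (@le_lt_trans _ _ (`|u 0 j| * \sum_(i | i != j) `|H i j|)).
  by rewrite mulr_sumr; apply: ler_sum => i _; rewrite normrM ler_wpM2r.
by rewrite ltr_pM2l.
Qed.

(** Monomials are encoded by exponent vectors; in degree [k] no exponent exceeds [k], so ['I_k.+1]
    loses nothing and keeps the type finite. *)
Definition sparse_monomials (M k t : nat) : {set {ffun 'I_M -> 'I_k.+1}} :=
  [set e : {ffun 'I_M -> 'I_k.+1} |
    (\sum_l e l == k)%N && (#|[set l | val (e l) != 0%N]%SET| <= t)%N]%SET.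

Lemma geom_sum_le (F : realFieldType) (x : F) (k : nat) :
  0 <= x < 1 -> (\sum_(b < k) x ^+ b.+1) * (1 - x) <= x.
Proof.
move=> /andP[x0 x1]; suff -> : (\sum_(b < k) x ^+ b.+1) * (1 - x) = x - x ^+ k.+1.
  by rewrite gerBl exprn_ge0.
elim: k => [|k IH]; first by rewrite big_ord0 expr1 mul0r subrr.
by rewrite big_ord_recr /= mulrDl IH (exprSr x k.+1); ring.
Qed.

(* Generating-function bound: each monomial of degree k and support at most t
   has weight at least x ^+ k * y ^+ t in the product over the variables of
   1 + y * (x + x ^ 2 + ...), here with x = 9/10. *)
Lemma card_sparse_monomials (F : realFieldType) (M k t : nat) (y : F) :
  0 < y <= 1 ->
  #|sparse_monomials M k t|%:R * (9 / 10) ^+ k * y ^+ t <= (1 + 9 * y) ^+ M.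
Proof.
move=> /andP[y0 y1]; set x : F := 9 / 10.
have x0 : 0 < x by rewrite /x; lra.
pose w (b : 'I_k.+1) : F := x ^+ b * y ^+ (val b != 0%N).
have w0 b : 0 <= w b by rewrite mulr_ge0 // exprn_ge0 // ltW.
apply: (@le_trans _ _ (\sum_(e : {ffun 'I_M -> 'I_k.+1}) \prod_l w (e l))).
  rewrite -mulrA mulr_natl -sumr_const.
  rewrite [leRHS](bigID (mem (sparse_monomials M k t))) /=.
  apply: ler_wpDr; first by apply: sumr_ge0 => e _; apply: prodr_ge0.
  apply: ler_sum => e; rewrite inE => /andP[/eqP ek et].
  rewrite big_split /= -!expr_sum ek ler_pM2l ?exprn_gt0 //.
  apply: ler_wiXn2l; rewrite ?(ltW y0) //.
  by rewrite -big_mkcond sum1_card in et *; move: et; rewrite cardsE.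
rewrite -(bigA_distr_bigA (fun _ => w)) prodr_const card_ord.
apply: lerXn2r; rewrite ?nnegrE ?sumr_ge0 //; first by lra.
rewrite big_ord_recl /w /= expr0 mulr1 lerD2l.
rewrite -mulr_suml mulrC -/w [9 * y]mulrC ler_pM2l //.
(* The 9 is [x / (1 - x)] at [x = 9/10]. *)
have := @geom_sum_le F x k; rewrite (ltW x0) /= => /(_ _).
have x1 : x < 1 by rewrite /x; lra.
move=> /(_ x1); set S := \sum_(b < k) _ => HS.
by move: HS; rewrite /x; lra.
Qed.

(** Expand the power over words [g] of length [k] and group them by letter counts [ex g]. The point
    is that [mu] does not depend on [z]. *)
Lemma expr_sum_monomials (R : comNzRingType) (M k : nat) :
  exists mu : {ffun 'I_M -> 'I_k.+1} -> nat,
   forall z : 'I_M -> R,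
  (\sum_l z l) ^+ k
    = \sum_(e : {ffun 'I_M -> 'I_k.+1} | (\sum_l e l == k)%N)
        (mu e)%:R * \prod_l z l ^+ e l.
Proof.
pose ct (g : {ffun 'I_k -> 'I_M}) l := #|[set a | g a == l]%SET|.
have ctk g l : (ct g l < k.+1)%N.
  by rewrite ltnS (leq_trans (max_card _)) ?card_ord.
pose ex g : {ffun 'I_M -> 'I_k.+1} := [ffun l => Ordinal (ctk g l)].
have ex_sum g : (\sum_l ex g l = k)%N.
  rewrite -[RHS]card_ord -sum1_card (partition_big g predT) //=.
  by apply: eq_bigr => l _; rewrite ffunE /= /ct -sum1_card; apply: eq_bigl => a; rewrite inE.
exists (fun e => #|[set g | ex g == e]%SET|) => z.
rewrite -[in LHS](card_ord k) -prodr_const (bigA_distr_bigA (fun _ => z)).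
rewrite (partition_big ex (fun e => (\sum_l e l == k)%N)) /=; last first.
  by move=> g _; rewrite ex_sum.
apply: eq_bigr => e _; rewrite -[X in X%:R]sum1_card natr_sum mulr_suml.
rewrite [RHS](eq_bigl (fun g => ex g == e)); last by move=> g; rewrite inE.
apply: eq_bigr => g /eqP <-; rewrite mul1r (partition_big g predT) //=.
apply: eq_bigr => l _; rewrite ffunE /= /ct -prodr_const.
by rewrite [RHS](eq_bigl (fun a => g a == l)) => [|a]; [apply: eq_bigr => a /eqP -> | rewrite inE].
Qed.

(* The entrywise k-th power factors through the monomials of degree k whose
   support is contained in that of a column of X. *)
Lemma sparse_factor_power_rank (F : fieldType) (p M k t : nat)
    (C : 'M[F]_(p, M)) (X : 'M[F]_(M, p)) :
  (forall j, #|[set l | X l j != 0%R]%SET| <= t)%N ->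
  (\rank (\matrix_(i, j) (C *m X) i j ^+ k) <= #|sparse_monomials M k t|)%N.
Proof.
move=> Xt; have [mu muE] := expr_sum_monomials F M k.
set W := sparse_monomials M k t.
pose ev (a : 'I_#|W|) : {ffun 'I_M -> 'I_k.+1} := enum_val a.
pose P : 'M[F]_(p, #|W|) := \matrix_(i, a) ((mu (ev a))%:R * \prod_l C i l ^+ ev a l).
pose Q : 'M[F]_(#|W|, p) := \matrix_(a, j) \prod_l X l j ^+ ev a l.
suff -> : \matrix_(i, j) (C *m X) i j ^+ k = P *m Q.
  by rewrite (leq_trans (mxrankM_maxl _ _)) // rank_leq_col.
apply/matrixP => i j; rewrite !mxE muE.
under [RHS]eq_bigr => a _ do rewrite !mxE.
transitivity (\sum_(e in W) (mu e)%:R * \prod_l C i l ^+ e l * \prod_l X l j ^+ e l);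
  last by rewrite big_enum_val.
rewrite (bigID (mem W)) /= [X in _ + X]big1 ?addr0 => [|e /andP[/eqP ek]].
  apply: eq_big => [e|e _]; first by rewrite !inE; case: eqP.
  by rewrite -mulrA -big_split /=; congr (_ * _); apply: eq_bigr => l _; rewrite exprMn.
rewrite inE ek eqxx /= -ltnNge => et.
suff [l el Xl] : exists2 l, val (e l) != 0%N & X l j = 0.
  by rewrite (bigD1 l) //= Xl mulr0 expr0n (negPf el) !mul0r mulr0.
have /subsetPn[l] : ~~ ([set l | val (e l) != 0%N]%SET \subset [set l | X l j != 0%R]%SET).
  by apply: contraL et => /subset_leq_card; rewrite -leqNgt => /leq_trans; exact.
by rewrite !inE negbK => el /eqP Xl; exists l.
Qed.

(** In the entrywise [k]-th power the diagonal is at least [(5/8)^k] and the rest of a column sums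
    to at most [(p-1) (3/8)^k], so [p <= (5/3)^k] gives dominance. The rank [p] is then at most the
    number of sparse monomials. *)
Lemma sparse_factor_near_id (F : realFieldType) (p M k t : nat) (y : F)
    (C : 'M[F]_(p, M)) (X : 'M[F]_(M, p)) :
  (forall j, #|[set l | X l j != 0%R]%SET| <= t)%N ->
  (forall i j, `|(C *m X) i j - (i == j)%:R| <= 3 / 8) ->
  0 < y <= 1 -> p%:R <= (5 / 3 : F) ^+ k ->
  p%:R * (9 / 10) ^+ k * y ^+ t <= (1 + 9 * y) ^+ M.
Proof.
move=> Xt Gnear y01 pk; set G := C *m X.
have rfree : row_free (\matrix_(i, j) G i j ^+ k).
  apply: col_dominant_row_free => j; rewrite mxE normrX.
  have Gjj : 5 / 8 <= `|G j j|.
    have := Gnear j j; rewrite eqxx -/G /= => /ler_normlP[h _].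
    by apply: le_trans (ler_norm _); lra.
  have Gij i : i != j -> `|G i j| <= 3 / 8.
    by move=> ij; have := Gnear i j; rewrite (negPf ij) subr0.
  apply: (@lt_le_trans _ _ ((5 / 8) ^+ k)); last by apply: lerXn2r; rewrite ?nnegrE //; lra.
  apply: (@le_lt_trans _ _ (\sum_(i | i != j) (3 / 8) ^+ k)).
    apply: ler_sum => i ij; rewrite mxE normrX.
    by apply: lerXn2r; rewrite ?nnegrE ?Gij //; lra.
  rewrite sumr_const (_ : #|_| = p.-1); last first.
    by rewrite -[p in RHS]card_ord -(cardC1 j); apply: eq_card => i; rewrite !inE.
  rewrite -[_ *+ p.-1]mulr_natl; have -> : 5 / 8 = 5 / 3 * (3 / 8) :> F by lra.
  have p0 : (0 < p)%N by exact: leq_ltn_trans (leq0n j) (ltn_ord j).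
  have pos38 : 0 < (3 / 8 : F) ^+ k by apply: exprn_gt0; lra.
  rewrite [ltRHS]exprMn (ltr_pM2r pos38).
  by apply: lt_le_trans pk; rewrite ltr_nat prednK.
apply: le_trans (card_sparse_monomials M k t y01).
have /andP[y0 _] := y01.
have pos : 0 <= (9 / 10) ^+ k * y ^+ t.
  by apply: mulr_ge0; apply: exprn_ge0; [lra | exact: ltW].
rewrite -!mulrA (ler_wpM2r pos) //.
by rewrite ler_nat -{1}(eqP rfree) sparse_factor_power_rank.
Qed.

(** * Logarithmic form of the sparsity bound *)

(** With [L = ln N]: [N >= 4^5] gives [ln p >= L - ln 4 >= 4L/5], while [(10/9)^4 <= 5/3] makes the
    factor [(9/10)^k] cost at most [(L + ln (5/3)) / 4 <= L/4 + L/40]. More than [L/2] remains. *)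
Lemma sparse_factor_log (R : realType) (N p M t : nat) (y : R)
    (C : 'M[R]_(p, M)) (X : 'M[R]_(M, p)) :
  (1024 <= N)%N -> (p <= N)%N -> (N <= 4 * p)%N ->
  (forall j, #|[set l | X l j != 0%R]%SET| <= t)%N ->
  (forall i j, `|(C *m X) i j - (i == j)%:R| <= 3 / 8) ->
  0 < y <= 1 ->
  ln N%:R / 2 <= t%:R * - ln y + 9 * y * M%:R.
Proof.
move=> N1024 pN Np Xt Gnear y01.
have y0 : 0 < y by case/andP: y01.
set L := ln N%:R.
have N1 : 1 <= N%:R :> R by rewrite ler1n; exact: leq_trans N1024.
have N0 : 0 < N%:R :> R by exact: lt_le_trans N1.
have le_lnX (x z : R) m : 0 < x -> x ^+ m <= z -> m%:R * ln x <= ln z.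
  move=> x0 xz; rewrite mulr_natl -lnXn // ler_ln ?posrE ?exprn_gt0 //.
  exact: lt_le_trans (exprn_gt0 _ x0) xz.
have ln4L : 5 * ln 4 <= L.
  by apply: le_lnX; [lra | rewrite -natrX ler_nat].
have ln53 : 2 * ln (5 / 3) <= ln 4 :> R by apply: le_lnX; lra.
have ln53_gt0 : 0 < ln (5 / 3) :> R by apply: ln_gt0; lra.
have ln910 : 0 <= ln (5 / 3) + 4 * ln (9 / 10) :> R.
  have : 4 * ln (10 / 9) <= ln (5 / 3) :> R by apply: le_lnX; lra.
  have -> : 10 / 9 = (9 / 10)^-1 :> R by field.
  by rewrite lnV ?posrE; lra.
have L0 : 0 <= L by exact: ln_ge0.
clear N1024.
have [k k2 kL] : exists2 k, L / ln (5 / 3) < k%:R & k%:R * ln (5 / 3) <= L + ln (5 / 3).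
  have /truncn_itv/andP[k1 k2] : 0 <= L / ln (5 / 3) by rewrite divr_ge0 // ltW.
  eexists; first exact: k2.
  by rewrite -addn1 natrD mulrDl mul1r lerD2r -ler_pdivlMr.
have pk : p%:R <= (5 / 3 : R) ^+ k.
  apply: (@le_trans _ _ N%:R); first by rewrite ler_nat.
  have h53 : 0 < (5 / 3 : R) ^+ k by apply: exprn_gt0; lra.
  rewrite -ler_ln ?posrE // lnXn; last by lra.
  by rewrite -[_ *+ k]mulr_natl; apply: ltW; rewrite -ltr_pdivrMr.
have p4 : N%:R <= 4 * p%:R :> R by rewrite -natrM ler_nat.
have p0 : 0 < p%:R :> R by lra.
have lnp : L <= ln 4 + ln p%:R by rewrite -lnM ?posrE ?ler_ln ?posrE //; lra.
have h9 : 0 < (9 / 10 : R) ^+ k by apply: exprn_gt0; lra.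
have hy : 0 < y ^+ t by apply: exprn_gt0.
have hM : 0 < (1 + 9 * y) ^+ M by apply: exprn_gt0; lra.
have hs := sparse_factor_near_id Xt Gnear y01 pk.
have hp9 : 0 < p%:R * (9 / 10) ^+ k :> R by exact: mulr_gt0.
have hp9y := mulr_gt0 hp9 hy.
have c9 : 0 < 9 / 10 :> R by lra.
have cy : 0 < 1 + 9 * y by lra.
have : ln (p%:R * (9 / 10) ^+ k * y ^+ t) <= ln ((1 + 9 * y) ^+ M).
  by rewrite ler_ln ?posrE.
rewrite [ln (_ * y ^+ t)]lnM ?posrE //.
rewrite [ln (_ * (9 / 10) ^+ k)]lnM ?posrE // !lnXn //.
rewrite -[_ *+ k]mulr_natl -[_ *+ t]mulr_natl -[_ *+ M]mulr_natl => h1.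
have h2 : M%:R * ln (1 + 9 * y) <= M%:R * (9 * y).
  by rewrite ler_wpM2l // le_ln1Dx //; lra.
have h3 : 0 <= k%:R * (ln (5 / 3) + 4 * ln (9 / 10)) :> R by rewrite mulr_ge0.
clear -ln4L ln53 kL lnp h1 h2 h3 ln53_gt0.
lra.
Qed.

(** * Rows with few large entries *)

Definition row_count (R : realType) (N : nat) (A : 'M[R]_N) (gamma : R) (i : 'I_N) : nat :=
  #|[set j | gamma < `|A i j|]%SET|.

Lemma few_light_rows (R : realType) (N n t : nat) (A : 'M[R]_N) (gamma y : R) :
  (1024 <= N)%N -> (0 < n)%N -> (\rank A <= n)%N ->
  (forall i j, `|A i j - (i == j)%:R| <= 1 / 3) ->
  0 <= gamma -> gamma ^+ 2 * (2 * n%:R) <= 1 / 576 -> 0 < y <= 1 ->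
  (N <= 2 * #|[set i | 8 * n * row_count A gamma i < N * t.+1]%N%SET|)%N ->
  ln N%:R / 2 <= t%:R * - ln y + 18 * y * n%:R.
Proof.
move=> N1024 n0 rA Anear g0 g2 y01; set Q := [set i | _]%SET => NQ.
pose h : 'I_#|Q| -> 'I_N := enum_val.
have hQ a : (8 * n * row_count A gamma (h a) < N * t.+1)%N.
  by have := enum_valP a; rewrite inE.
have h_inj : injective h by exact: enum_val_inj.
(* Restricting rows and columns to [Q] keeps [B] near the identity and makes every possible frame
   row light. *)
pose B := mxsub h h A.
have Q0 : (0 < #|Q|)%N by lia.
have rB : (\rank B <= n)%N.
  apply: leq_trans rA; rewrite /B mxsubrc.
  apply: leq_trans (mxrankS (rowsub_sub _ _)) _.
  by rewrite -mxrank_tr trmx_mxsub -[\rank A]mxrank_tr mxrankS // rowsub_sub.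
have [f [C [BC C1]]] := rank_row_frame Q0 rB.
pose S a := [set l | gamma < `|B (f l) a|]%SET.
pose J := [set a | #|S a| <= t]%N%SET.
have sumS : (\sum_a #|S a| <= \sum_l row_count A gamma (h (f l)))%N.
  under eq_bigr do rewrite -sum1_card big_mkcond.
  rewrite exchange_big /=; apply: leq_sum => l _.
  rewrite -big_mkcond /= /row_count.
  rewrite (eq_bigl (fun a => a \in [set a | gamma < `|B (f l) a|]%SET)); last first.
    by move=> a; rewrite !inE.
  rewrite sum1_card -(card_imset _ h_inj); apply: subset_leq_card.
  by apply/fintype.subsetP => _ /imsetP[a + ->]; rewrite !inE mxE.
(* Each of the [2n] frame rows has fewer than [N (t+1) / (8n)] large entries. *)
have sumD : (4 * \sum_l row_count A gamma (h (f l)) <= N * t.+1)%N.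
  have : (\sum_(l < 2 * n) 8 * n * row_count A gamma (h (f l))
          <= \sum_(l < 2 * n) N * t.+1)%N by apply: leq_sum => l _; exact/ltnW.
  by rewrite -big_distrr sum_nat_const card_ord /=; move: (\sum_l _)%N => s; nia.
(* Markov's inequality: a column outside [J] has at least [t+1] large entries, so at most [N/4]
   columns are lost out of at least [N/2]. *)
have badJ : (#|~: J| * t.+1 <= \sum_a #|S a|)%N.
  rewrite -sum_nat_const [leqRHS](bigID (mem (~: J))) /= -[leqLHS]addn0 leq_add //.
  by apply: leq_sum => a; rewrite !inE -ltnNge.
have J4 : (N <= 4 * #|J|)%N.
  have := cardsC J; rewrite card_ord => eJ.
  have : (4 * #|~: J| * t.+1 <= N * t.+1)%N by rewrite -mulnA; lia.
  by rewrite leq_pmul2r //; lia.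
have JN : (#|J| <= N)%N.
  by rewrite (leq_trans (max_card _)) // card_ord (leq_trans (max_card _)) ?card_ord.
pose e : 'I_#|J| -> 'I_#|Q| := enum_val.
have eJ b : (#|S (e b)| <= t)%N by have := enum_valP b; rewrite inE.
pose X : 'M[R]_(2 * n, #|J|) :=
  \matrix_(l, b) (if gamma < `|B (f l) (e b)| then B (f l) (e b) else 0).
have -> : 18 * y * n%:R = 9 * y * (2 * n)%:R :> R by rewrite natrM; ring.
apply: (@sparse_factor_log _ _ _ _ _ _ (rowsub e C) X) => // [b|a b].
  apply: leq_trans (eJ b); apply: subset_leq_card; apply/fintype.subsetP => l.
  by rewrite !inE mxE; case: ifP => //; rewrite eqxx.
have eab : (a == b) = (h (e a) == h (e b)).
  by rewrite (inj_eq h_inj) (inj_eq enum_val_inj).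
have -> : (rowsub e C *m X) a b - (a == b)%:R
   = (A (h (e a)) (h (e b)) - (h (e a) == h (e b))%:R) - (B (e a) (e b) - (rowsub e C *m X) a b).
  by rewrite eab [B _ _]mxE; ring.
apply: le_trans (ler_normB _ _) _.
(* Since 1/3 + 1/24 = 3/8. The 1/24 splits into 1/48 from the norm of the coefficient row and 1/48
   from the bound on [gamma]. *)
suff hB : `|B (e a) (e b) - (rowsub e C *m X) a b| <= 1 / 24.
  by have := Anear (h (e a)) (h (e b)); lra.
rewrite {1}BC !mxE -sumrB.
apply: le_trans (ler_norm_sum _ _ _) _.
(* AM-GM: [|c b| <= c^2 / 48 + 12 b^2] *)
apply: (@le_trans _ _ (\sum_l (C (e a) l ^+ 2 / 48 + 12 * gamma ^+ 2))).
  apply: ler_sum => l _; rewrite !mxE -mulrBr normrM.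
  set c := C _ _; set v := A _ _.
  have [gv|] := ltrP gamma `|v|.
    by rewrite subrr normr0 mulr0; have := sqr_ge0 c; have := sqr_ge0 gamma; lra.
  rewrite subr0 -(real_normK (num_real c)) => gv.
  have := sqr_ge0 (`|c| - 24 * `|v|); have := normr_ge0 v; nra.
rewrite big_split /= -mulr_suml sumr_const card_ord -[_ *+ (2 * n)]mulr_natl natrM.
have := C1 (e a); lra.
Qed.

(** * Size of [log N] and of the threshold *)

Lemma ln_natr_gt0 (R : realType) (N : nat) : (2 <= N)%N -> 0 < ln N%:R :> R.
Proof. by move=> N2; apply: ln_gt0; rewrite ltr1n. Qed.

Lemma ln_natr_le_rank (R : realType) (N : nat) (A : 'M[R]_N) :
  (2 <= N)%N -> (forall i j, `|A i j - (i == j)%:R| <= 1 / 3) ->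
  ln N%:R <= 18 * (\rank A)%:R :> R.
Proof.
move=> N2 Anear.
have r0 : (0 < \rank A)%N.
  rewrite lt0n mxrank_eq0; apply/eqP => A0.
  have i0 : 'I_N by exact: Ordinal N2.
  have := Anear i0 i0; rewrite A0 mxE eqxx sub0r normrN normr1; lra.
have r1 : 1 <= (\rank A)%:R :> R by rewrite ler1n.
have [Nsmall|Nbig] := ltnP N 1024.
  have ln2 : ln 2 <= 1 :> R by have := @le_ln1Dx R 1; rewrite -[1 + 1]/(2 : R); apply; lra.
  apply: (@le_trans _ _ (10 * ln 2)); last by lra.
  rewrite mulr_natl -lnXn // ler_ln ?posrE ?exprn_gt0 ?ltr0n //; last exact: leq_trans N2.
  by rewrite -natrX ler_nat ltnW.
(* In a rank factorization every column is trivially [t]-sparse for [t = \rank A]; taking [y = 1]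
   removes the term in [t]. *)
have := @sparse_factor_log R N N (\rank A) (\rank A) 1 (col_base A) (row_base A) Nbig.
rewrite ln1 oppr0 mulr0 add0r mulr1 mulmx_base leqnn ltr01 lexx => H.
suff : ln N%:R / 2 <= 9 * (\rank A)%:R :> R by lra.
apply: H => //; first by lia.
  by move=> j; rewrite (leq_trans (max_card _)) ?card_ord.
by move=> i j; apply: le_trans (Anear i j) _; lra.
Qed.

Lemma entry_distribution_row_count (R : realType) (N : nat) (A : 'M[R]_N) (gamma : R) :
  entry_distribution A gamma = (\sum_i row_count A gamma i)%:R / N%:R ^+ 2.
Proof.
rewrite /entry_distribution; congr (_%:R / _).
rewrite -sum1_card (eq_bigl (fun ij => gamma < `|A ij.1 ij.2|)); last by move=> ij; rewrite inE.
rewrite -(pair_big_dep xpredT (fun i j => gamma < `|A i j|) (fun _ _ => 1%N)) /=.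
by apply: eq_bigr => i _; rewrite /row_count -sum1_card; apply: eq_bigl => j; rewrite inE.
Qed.

(** Both terms of the maximum are at most [18 n^(-1/2)]: the first by [ln N <= 18 n], the second by
    [n >= 1]. *)
Lemma threshold_sq_le (R : realType) (c : R) (N n : nat) :
  0 <= c -> (0 < n)%N -> (0 < N)%N -> ln N%:R <= 18 * n%:R :> R ->
  threshold c N n ^+ 2 * n%:R <= (18 * c) ^+ 2.
Proof.
move=> c0 n0 N0 Ln; rewrite /threshold.
have n1 : 1 <= n%:R :> R by rewrite ler1n.
have ngt : 0 < n%:R :> R by rewrite ltr0n.
have L0 : 0 <= ln N%:R :> R by apply: ln_ge0; rewrite ler1n.
suff H : Num.max (n%:R `^ (- (3 / 2)) * ln N%:R) n%:R^-1 ^+ 2 * n%:R <= 18 ^+ 2 :> R.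
  rewrite exprMn -mulrA [leRHS]exprMn [leRHS]mulrC ler_wpM2l ?sqr_ge0 //.
rewrite maxEle; case: ifP => _.
  have -> : n%:R^-1 ^+ 2 * n%:R = n%:R^-1 :> R by field; lra.
  have : n%:R^-1 <= 1 :> R by rewrite invf_le1.
  lra.
have -> : (n%:R `^ (- (3 / 2)) * ln N%:R) ^+ 2 = (n%:R^-1) ^+ 3 * ln N%:R ^+ 2 :> R.
  rewrite exprMn -[(_ `^ _) ^+ 2]powR_mulrn ?powR_ge0 // -powRrM.
  have -> : - (3 / 2) * 2%:R = - 3%:R :> R by field.
  by rewrite powRN powR_mulrn // exprVn.
have -> : (n%:R^-1) ^+ 3 * ln N%:R ^+ 2 * n%:R = (ln N%:R / n%:R) ^+ 2 :> R by field; lra.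
by apply: lerXn2r; rewrite ?nnegrE ?divr_ge0 // ler_pdivrMr.
Qed.

Lemma row_count_gt0 (R : realType) (N : nat) (A : 'M[R]_N) (gamma : R) (i : 'I_N) :
  (forall i j, `|A i j - (i == j)%:R| <= 1 / 3) -> gamma < 2 / 3 ->
  (0 < row_count A gamma i)%N.
Proof.
move=> Anear g23; rewrite card_gt0; apply/set0Pn; exists i; rewrite inE.
have := Anear i i; rewrite eqxx /= => /ler_normlP[h _].
by apply: lt_le_trans g23 (le_trans _ (ler_norm _)); lra.
Qed.

Lemma ln2_ge_half (R : realType) : 1 / 2 <= ln 2 :> R.
Proof.
have := @le_ln1Dx R (- (1 / 2)).
have -> : 1 - 1 / 2 = 2^-1 :> R by field.
rewrite lnV ?posrE // => H; have : - ln 2 <= - (1 / 2) :> R by apply: H; lra.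
by lra.
Qed.

(** * Choice of parameters and final count *)

Lemma heavy_rows (R : realType) (N t : nat) (A : 'M[R]_N) (gamma : R) :
  (1024 <= N)%N ->
  (forall i j, `|A i j - (i == j)%:R| <= 1 / 3) ->
  0 <= gamma -> gamma ^+ 2 * (2 * (\rank A)%:R) <= 1 / 576 ->
  t%:R * (64 * ln (2 + (\rank A)%:R / ln N%:R)) <= ln N%:R :> R ->
  (2 * #|[set i | 8 * \rank A * row_count A gamma i < N * t.+1]%N%SET| < N)%N.
Proof.
move=> N1024 Anear g0 g2 tL; rewrite ltnNge; apply/negP => NQ.
have N2 : (2 <= N)%N by exact: leq_trans N1024.
have L0 := ln_natr_gt0 R N2; have Ln := ln_natr_le_rank N2 Anear.
have n0 : (0 < \rank A)%N by rewrite -(ltr0n R); clear -L0 Ln; lra.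
move: tL g2; set L : R := ln N%:R in L0 Ln *; set n : R := (\rank A)%:R in Ln *.
set lam : R := ln (2 + n / L) => tL g2.
have npos : 0 < n by rewrite ltr0n.
have nL : 0 < n / L by exact: divr_gt0.
have lam2 : ln 2 <= lam by rewrite /lam ler_ln ?posrE; lra.
have lam_nL : ln (n / L) <= lam by rewrite /lam ler_ln ?posrE; lra.
(* Chosen so that [18 y n = L/4]; also [- ln y <= 8 lam] as [72 <= 2^7], so the term in [t] is at
   most [L/8], and [L/8 + L/4 < L/2]. *)
pose y := (n / L * 72)^-1.
have yinv : 0 < n / L * 72 by rewrite mulr_gt0.
have y01 : 0 < y <= 1.
  rewrite invr_gt0 yinv /= invf_le1 //.
  by rewrite mulrAC ler_pdivlMr //; lra.
have yn : 18 * y * n = L / 4 by rewrite /y; field; lra.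
have ln72 : ln 72 <= 7 * ln 2 :> R.
  rewrite mulr_natl -lnXn // ler_ln ?posrE ?exprn_gt0 //; lra.
have lny : - ln y = ln (n / L) + ln 72 by rewrite /y lnV ?posrE // opprK lnM ?posrE.
have := few_light_rows N1024 n0 (leqnn _) Anear g0 g2 y01 NQ.
rewrite -/L -/n yn lny => main.
have h1 : t%:R * (ln (n / L) + ln 72) <= t%:R * (8 * lam) by apply: ler_wpM2l => //; lra.
have h2 : t%:R * (8 * lam) <= L / 8 by lra.
have : L / 2 <= L / 8 + L / 4 by apply: le_trans main _; rewrite lerD2r (le_trans h1).
by clear -L0; lra.
Qed.

Theorem mainTheorem1 (R : realType) :
  exists2 c : R, 0 < c &
    forall (N n : nat) (A : 'M[R]_N),
      (2 <= N)%N ->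
      \rank A = n ->
      max_entry_dist_id A <= 1 / 3 ->
      c * (ln N%:R / (n%:R * ln (2 + n%:R / ln N%:R)))
        <= entry_distribution A (threshold c N n).
Proof.
(* [c0] is 1/1024, kept opaque with [c]. For [N < 1024], [c N^2 <= 1/2]; for larger [N],
   [1024 c <= 1] is what the count requires. *)
have [c0 c0E] : {c0 : R | c0 = (1 / 32) ^+ 2} by eexists.
have [c cE] : {c : R | c = c0 ^+ 2 / 2} by eexists.
have c0_gt0 : 0 < c0 by rewrite c0E; lra.
have c0_le : c0 <= 1 / 1000 by rewrite c0E; lra.
have c_gt0 : 0 < c by rewrite cE; nra.
have c_le : c <= c0 / 2000 by rewrite cE; nra.
exists c => // N n A N2 <-{n} Adist; set n : R := (\rank A)%:R.
have Anear i j : `|A i j - (i == j)%:R| <= 1 / 3.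
  apply: le_trans Adist; apply: le_trans (le_bigmax _ _ i).
  exact: (le_bigmax _ (fun j => `|A i j - (i == j)%:R|)).
have N0 : (0 < N)%N by exact: ltnW.
have NR : 0 < N%:R :> R by rewrite ltr0n.
have L0 := ln_natr_gt0 R N2; have Ln := ln_natr_le_rank N2 Anear.
have n0 : (0 < \rank A)%N by rewrite -(ltr0n R); clear -L0 Ln; lra.
have n1 : 1 <= n by rewrite ler1n.
have thr := threshold_sq_le (ltW c_gt0) n0 N0 Ln.
have thr0 : 0 <= threshold c N (\rank A).
  by apply: mulr_ge0; [exact: ltW | rewrite le_max invr_ge0 ler0n orbT].
move: thr thr0; set gamma := threshold _ _ _ => thr thr0.
rewrite -/n in thr Ln *; set L : R := ln N%:R in L0 Ln *.
set lam := ln (2 + n / L).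
have lam2 : 1 / 2 <= lam.
  apply: le_trans (ln2_ge_half R) _; rewrite /lam.
  have : 0 < n / L by apply: divr_gt0 => //; lra.
  by move=> h; rewrite ler_ln ?posrE; lra.
have nlam : 0 < n * lam by apply: mulr_gt0; lra.
rewrite entry_distribution_row_count mulrA ler_pdivrMr // mulrAC ler_pdivlMr ?exprn_gt0 //.
have g18 : gamma <= 18 * c.
  have c18 : 0 <= 18 * c by lra.
  rewrite -ler_sqr ?nnegrE //; apply: le_trans thr.
  by rewrite ler_peMr ?sqr_ge0.
(* For small [N] the [N] diagonal entries suffice, given [L <= N] and [n lam >= 1/2]. *)
have [Nsmall|Nbig] := ltnP N 1024.
  have c0N : c0 * N%:R <= 1.
    have -> : c0 = ((2 ^ 10)%:R)^-1 by rewrite natrX c0E; field.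
    by rewrite mulrC ler_pdivrMr ?ltr0n ?expn_gt0 // mul1r ler_nat ltnW.
  clear Nsmall.
  have LN : L <= N%:R by rewrite ltW // ln_sublinear.
  have SN : N%:R <= (\sum_i row_count A gamma i)%:R :> R.
    rewrite ler_nat -[leqLHS]card_ord -sum1_card; apply: leq_sum => i _.
    by apply: row_count_gt0 Anear _; lra.
  have cN : c * N%:R ^+ 2 <= 1 / 2.
    have : (c0 * N%:R) ^+ 2 <= 1 by rewrite expr_le1 // mulr_ge0 // ltW.
    by rewrite cE; lra.
  apply: (@le_trans _ _ (N%:R * (1 / 2))).
    by rewrite mulrAC mulrC; apply: ler_pM => //; [exact: ltW | rewrite mulr_ge0 ?exprn_ge0 // ltW].
  by apply: ler_pM => //; nra.
(* The largest [t] allowed by [heavy_rows]. It may be 0, so the count uses [t+1], which still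
   exceeds [L / (64 lam)]. *)
pose t := Num.truncn (L / (64 * lam)).
have lam64 : 0 < 64 * lam by lra.
have /truncn_itv/andP[t1 t2] : 0 <= L / (64 * lam) by rewrite divr_ge0 // ltW.
have heavy : (2 * #|[set i | 8 * \rank A * row_count A gamma i < N * t.+1]%N%SET| < N)%N.
  apply: heavy_rows => //; last by rewrite -ler_pdivlMr.
  have : 18 * c <= 1 / 100 by clear -c_le c0_le; lra.
  have : 0 <= 18 * c by clear -c_gt0; lra.
  rewrite -/n; clear -thr; nra.
(* At least [N/2] rows lie outside [Q], each with at least [N (t+1) / (8n)] large entries; 16 * 64 =
   1024 gives the constant in [h3]. *)
have count : (N * (N * t.+1) <= 16 * \rank A * \sum_i row_count A gamma i)%N.
  move: heavy; set Q := [set i | _]%SET => heavy.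
  have := cardsC Q; rewrite card_ord => eQ.
  have NQ : (N <= 2 * #|~: Q|)%N by clear -heavy eQ; lia.
  apply: (@leq_trans (2 * (#|~: Q| * (N * t.+1)))).
    by rewrite [leqRHS]mulnA leq_mul2r NQ orbT.
  rewrite -[16%N]/(2 * 8)%N -!mulnA leq_mul2l /= [leqRHS]mulnA.
  rewrite -sum_nat_const big_distrr /= [leqRHS](bigID (mem (~: Q))) /= -[leqLHS]addn0 leq_add //.
  by apply: leq_sum => i; rewrite !inE -leqNgt.
clear heavy Nbig.
move: count; rewrite -(ler_nat R) !natrM -/n.
move: (\sum_i _)%N => S count.
have S0 : 0 <= S%:R :> R by [].
have tL : L <= t.+1%:R * (64 * lam) by rewrite -ler_pdivrMr // ltW.
have N20 : 0 <= N%:R ^+ 2 :> R by exact: sqr_ge0.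
have h1 : L * N%:R ^+ 2 <= N%:R ^+ 2 * (t.+1%:R * (64 * lam)).
  by rewrite mulrC ler_wpM2l.
have h2 : N%:R * (N%:R * t.+1%:R) * (64 * lam) <= 16 * n * S%:R * (64 * lam).
  by rewrite ler_wpM2r // ltW.
have h3 : L * N%:R ^+ 2 <= 1024 * (S%:R * (n * lam)) by lra.
have SnL : 0 <= S%:R * (n * lam) by rewrite mulr_ge0 // ltW.
rewrite -mulrA; apply: le_trans (ler_wpM2l (ltW c_gt0) h3) _.
have h4 : c * 1024 <= 1 by clear -c_le c0_le; lra.
by rewrite [leLHS]mulrA -[leRHS]mul1r ler_wpM2r.
Qed.
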